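(* Let $\widetilde{W}$ be an irreducible affine Weyl group with positive system $\widetilde\Phi^+=\widehat\Phi$, and let $X\subset\widetilde{W}$. If $\overline{\bigcup_{x\in X}\Phi_x}$ is finite, then it is biclosed (in $\widetilde\Phi^+$) and the join of $X$ exists (in $\widetilde W$ under the weak order).
   Context: Affine setting: $\Phi$ is the irreducible crystallographic root system (finite and reduced) of a Weyl group, spanning a Euclidean space $V$ with inner product $(\cdot,\cdot)$, with a fixed positive system $\Phi^+$, simple system $\Pi$, $\Phi^-=-\Phi^+$. Let $V'=V\oplus\mathbb{R}\delta$, with the inner product extended by $(\delta,V')=0$. For $\alpha\in\Phi^+$ let $\widehat{\alpha}=\{\alpha+n\delta : n\in\mathbb{Z}_{\ge0}\}$; for $\alpha\in\Phi^-$ let $\widehat{\alpha}=\{\alpha+(n+1)\delta : n\in\mathbb{Z}_{\ge0}\}$; $\widehat{\Phi}=\bigcup_{\alpha\in\Phi}\widehat{\alpha}$. The affine Weyl group $\widetilde{W}$ is the Coxeter group generated by the reflections $s_\rho(v)=v-\frac{2(v,\rho)}{(\rho,\rho)}\rho$ of $V'$, $\rho\in\widehat\Phi$; its root system is $\widehat{\Phi}\cup-\widehat{\Phi}$, positive system $\widetilde\Phi^+=\widehat{\Phi}$, simple roots $\Pi\cup\{\delta-\gamma\}$ with $\gamma$ the highest root of $\Phi$. For $x\in\widetilde W$, $\Phi_x=\{\rho\in\widetilde\Phi^+ : x^{-1}(\rho)\in-\widetilde\Phi^+\}$; the weak order on $\widetilde W$ is $x\le y\iff\Phi_x\subset\Phi_y$.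 A set $\Gamma\subset\widetilde\Phi^+$ is closed if $\alpha,\beta\in\Gamma$, $k_1,k_2\in\mathbb{R}_{\ge0}$ and $k_1\alpha+k_2\beta\in\widetilde\Phi^+$ imply $k_1\alpha+k_2\beta\in\Gamma$; it is biclosed if both $\Gamma$ and $\widetilde\Phi^+\setminus\Gamma$ are closed. $\overline{Y}$ denotes the closure of $Y\subset\widetilde\Phi^+$, i.e. the smallest closed subset of $\widetilde\Phi^+$ containing $Y$. *)

(* Defs.v *)
From HB Require Import structures.
From mathcomp Require Import all_boot all_order all_algebra.
From mathcomp Require Import boolp classical_sets functions cardinality reals.

Set Implicit Arguments.
Unset Strict Implicit.
Unset Printing Implicit Defensive.

Import Order.TTheory GRing.Theory Num.Theory.
Local Open Scope classical_set_scope.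
Local Open Scope ring_scope.

Section FiniteRootSystem.
Variables (R : realType) (V : vectType R) (dot : {dot V for idfun}).
Implicit Types (Phi : set V).

Definition spans Phi : Prop :=
  forall U : {vspace V}, (forall a, Phi a -> a \in U) -> U = fullv.

Record crystallographic_root_system Phi : Prop := CrystallographicRootSystem {
  root_finite : finite_set Phi;
  root_neq0 : ~ Phi 0;
  root_span : spans Phi;
  root_reflect : forall a b, Phi a -> Phi b ->
    Phi (b - (2 * dot b a / dot a a) *: a);
  root_reduced : forall a (c : R), Phi a -> Phi (c *: a) -> c = 1 \/ c = - 1;
  root_integral : forall a b, Phi a -> Phi b ->
    exists z : int, 2 * dot b a / dot a a = z%:~R
}.

Definition irreducible_root_system Phi : Prop :=
  Phi !=set0 /\
  forall A B : set V, A `|` B = Phi ->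
    (forall a b, A a -> B b -> dot a b = 0) -> A = set0 \/ B = set0.

Variable n : nat.
Implicit Type Pi : n.-tuple V.

Definition simple_system Phi Pi : Prop :=
  [/\ forall a, a \in Pi -> Phi a,
      basis_of fullv Pi &
      forall a, Phi a ->
        (forall i, 0 <= coord Pi i a) \/ (forall i, coord Pi i a <= 0)].

Definition positive_roots Phi Pi : set V :=
  [set a | Phi a /\ forall i, 0 <= coord Pi i a].

Definition negative_roots Phi Pi : set V := -%R @` positive_roots Phi Pi.

End FiniteRootSystem.

Section AffineWeylGroup.
Variables (R : realType) (V : vectType R) (dot : {dot V for idfun}).

(* The pair (v, c) stands for v + c delta. *)
Definition affine_space : vectType R := (V * R^o)%type.

Local Notation V' := affine_space.

Definition delta : V' := (0, 1).

Definition embed (v : V) : V' := (v, 0).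

Definition affine_dot (u v : V') : R := dot u.1 v.1.

Definition reflection_fun (r v : V') : V' :=
  v - (2 * affine_dot v r / affine_dot r r) *: r.

Definition reflection (r : V') : 'End(V') := linfun (reflection_fun r).

(* linfun is only meaningful on linear functions. *)
Lemma reflectionE (r v : V') : reflection r v = reflection_fun r v.
Proof.
have lin : linear (reflection_fun r).
  move=> a u w; rewrite /reflection_fun /affine_dot /=.
  rewrite linearPl /= mulrDr mulrDl scalerDl opprD scalerBr scalerA.
  by rewrite !mulrA (mulrC 2 a) addrACA.
pose f := HB.pack_for {linear V' -> V'} (reflection_fun r)
  (GRing.isLinear.Build R V' V' *:%R (reflection_fun r) lin).
exact: (lfunE f v).
Qed.

Variables (n : nat) (Phi : set V) (Pi : n.-tuple V).

Definition hat (a : V) : set V' :=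
  [set r | exists k : nat,
     (positive_roots Phi Pi a /\ r = embed a + k%:R *: delta) \/
     (negative_roots Phi Pi a /\ r = embed a + k.+1%:R *: delta)].

Definition affine_positive_roots : set V' := \bigcup_(a in Phi) hat a.

Definition affine_negative_roots : set V' := -%R @` affine_positive_roots.

(* All generated maps are bijective, so the lfun inverse is the inverse. *)
Inductive affine_weyl_group : set 'End(V') :=
| Weyl_id : affine_weyl_group \1%VF
| Weyl_reflection r :
    affine_positive_roots r -> affine_weyl_group (reflection r)
| Weyl_comp x y : affine_weyl_group x -> affine_weyl_group y ->
    affine_weyl_group (x \o y)%VF
| Weyl_inv x : affine_weyl_group x -> affine_weyl_group (x^-1)%VF.

Definition inversion_set (x : 'End(V')) : set V' :=
  [set r | affine_positive_roots r /\ affine_negative_roots ((x^-1)%VF r)].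

Definition weak_le (x y : 'End(V')) : Prop :=
  inversion_set x `<=` inversion_set y.

Definition closed_roots (G : set V') : Prop :=
  G `<=` affine_positive_roots /\
  forall (a b : V') (k1 k2 : R), G a -> G b -> 0 <= k1 -> 0 <= k2 ->
    affine_positive_roots (k1 *: a + k2 *: b) -> G (k1 *: a + k2 *: b).

Definition biclosed_roots (G : set V') : Prop :=
  closed_roots G /\ closed_roots (affine_positive_roots `\` G).

Definition closure_roots (Y : set V') : set V' := smallest closed_roots Y.

Definition is_join (X : set 'End(V')) (z : 'End(V')) : Prop :=
  [/\ affine_weyl_group z,
      forall x, X x -> weak_le x z &
      forall w, affine_weyl_group w -> (forall x, X x -> weak_le x w) ->
        weak_le z w].

End AffineWeylGroup.

(* Main.v *)
(** Let C be the finite closure and consider the Weyl group elements w whose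
    inversion set N(w) lies in C. If w is such an element, a and b are distinct
    simple roots and w a, w b are positive roots in C, then C contains the
    positive roots in the cone spanned by w a and w b; going up as far as
    possible in the coset of w by the dihedral group generated by s_a and s_b
    therefore ends, at an element w' with N(w) <= N(w') <= C and w a, w b in
    N(w'). So going up by simple reflections inside C terminates and is locally
    confluent. As in Newman's lemma, all maximal elements have the same
    inversion set N(z), which contains N(x) for all x with N(x) <= C. Since N(z)
    is biclosed, C = N(z), and z is the join.

    A simple root means here a positive root a such that s_a permutes the other
    positive roots. That there are enough of them follows from convexity, the
    positive roots being those on which a suitable linear form is positive. *)

From HB Require Import structures.
Require Import Defs.
From mathcomp Require Import all_boot all_order all_algebra finmap ring lra.
From mathcomp Require Import boolp classical_sets cardinality reals.

Set Implicit Arguments.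
Unset Strict Implicit.
Unset Printing Implicit Defensive.

Import Order.TTheory GRing.Theory Num.Theory.
Local Open Scope classical_set_scope.
Local Open Scope ring_scope.

(** * Maximal elements and upward induction in a finite set *)

Section FiniteSets.

Lemma finite_set_argmax d (R : orderType d) (T : choiceType) (A : set T)
    (F : T -> R) :
  finite_set A -> A !=set0 ->
  exists2 x, A x & forall y, A y -> (F y <= F x)%O.
Proof.
move=> /finite_seqP[s ->] [x0 /=].
elim: s x0 => [//|y s IH] x0 _.
have [->|[z zs]] : s = [::] \/ exists z, z \in s.
  by case: s {IH} => [|z s]; [left|right; exists z; rewrite mem_head].
  by exists y; rewrite /= ?mem_head // => z; rewrite inE => /eqP ->.
have [x /= xs xmax] := IH z zs.
have [yx|xy] := leP (F y) (F x).
  exists x; rewrite /= ?inE ?xs ?orbT // => t; rewrite inE.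
  by case/orP => [/eqP ->|/xmax].
exists y; rewrite /= ?mem_head // => t; rewrite inE.
case/orP => [/eqP -> //|/xmax tx].
exact: le_trans tx (ltW xy).
Qed.

(** Induction on the number of elements of [C] outside [A], which drops whenever [A] grows strictly.
    It serves as the termination argument for going up inside [C]. *)
Lemma finite_superset_ind (T : choiceType) (C : set T) (Q : set T -> Prop) :
  finite_set C ->
  (forall A, A `<=` C ->
    (forall B, B `<=` C -> A `<=` B -> ~ B `<=` A -> Q B) -> Q A) ->
  forall A, A `<=` C -> Q A.
Proof.
move=> finC step A AC.
have [m] := ubnP #|` fset_set (C `\` A)|.
elim: m A AC => // m IH A AC leAm; apply: step => // B BC AB nBA.
apply: IH => //; rewrite ltnS in leAm; apply: leq_trans leAm.
have finD D : finite_set (C `\` D) by exact: finite_setD.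
apply: fproper_ltn_card; rewrite fproperE; apply/andP; split.
  by rewrite -fset_set_sub // => x [Cx nBx]; split=> // /AB.
apply/negP; rewrite -fset_set_sub // => sAB; apply: nBA => x Bx.
by apply: contrapT => nAx; case: (sAB x); [split; [exact: BC|]|].
Qed.

Lemma finite_maximal_superset (T : choiceType) (C : set T)
    (Q : set T -> Prop) A :
  finite_set C -> (forall B, Q B -> B `<=` C) -> Q A ->
  exists B, [/\ Q B, A `<=` B & forall D, Q D -> B `<=` D -> D `<=` B].
Proof.
move=> finC QC QA; have := QA; have := QC A QA.
move: A {QA}; apply: finite_superset_ind finC _ => A AC IH QA.
have [[B [QB AB nBA]]|Amax] :=
  pselect (exists B, [/\ Q B, A `<=` B & ~ B `<=` A]).
  have [D [QD BD Dmax]] := IH B (QC B QB) AB nBA QB.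
  by exists D; split=> //; exact: subset_trans BD.
exists A; split=> // D QD AD; apply: contrapT => nDA; apply: Amax.
by exists D.
Qed.

End FiniteSets.

(** * A strictly convex function on the space *)

Section SquareNorm.
Variables (R : realFieldType) (E : vectType R).
Implicit Types u v : E.

Definition sqnorm v : R := \sum_i coord (vbasis {:E}) i v ^+ 2.

Lemma sqnorm_ge0 v : 0 <= sqnorm v.
Proof. by apply: sumr_ge0 => i _; exact: sqr_ge0. Qed.

Lemma sqnorm_eq0 v : sqnorm v = 0 -> v = 0.
Proof.
move=> /psumr_eq0P q0; rewrite [v](coord_vbasis (memvf v)) big1 // => i _.
apply/eqP; rewrite scaler_eq0 -sqrf_eq0 q0 ?eqxx // => j _; exact: sqr_ge0.
Qed.

(** The last term makes convexity strict, so a point maximizing [sqnorm] is not strictly between two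
    distinct competitors. *)
Lemma sqnorm_convex (l : R) u v :
  sqnorm (l *: u + (1 - l) *: v) =
  l * sqnorm u + (1 - l) * sqnorm v - l * (1 - l) * sqnorm (u - v).
Proof.
rewrite /sqnorm !mulr_sumr -big_split /= -sumrB; apply: eq_bigr => i _.
by rewrite linearB linearD !linearZ /=; ring.
Qed.

End SquareNorm.

(** * Simple roots from a linear form positive on the positive roots *)

Section RootsAndInversions.
Variables (R : realFieldType) (E : vectType R) (T : set E).
Variables (f : {scalar E}) (h : E -> E -> R) (s : E -> 'End(E)).

Hypothesis sE : forall r v, s r v = v - h r v *: r.
Hypothesis h_root : forall r, T r -> h r r = 2.
Hypothesis s_root : forall r v, T r -> T v -> T (s r v).
Hypothesis T_opp : forall r, T r -> T (- r).
Hypothesis f_neq0 : forall r, T r -> f r != 0.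

Local Notation P := [set r | T r /\ 0 < f r].

Hypothesis P_reduced : forall r (t : R), P r -> P (t *: r) -> t = 1.

Lemma root_sign r : T r -> P r \/ P (- r).
Proof.
move=> Tr; have := f_neq0 Tr; rewrite neq_lt => /orP[fr|fr]; [right|left] => //.
by split; [exact: T_opp | rewrite linearN oppr_gt0].
Qed.

Definition simple_root a := P a /\ forall r, P r -> r <> a -> P (s a r).

Lemma reflect_self a : T a -> s a a = - a.
Proof. by move=> Ta; rewrite sE h_root // scaler_nat mulr2n opprD addNKr. Qed.

Lemma reflectK a v : T a -> s a (s a v) = v.
Proof.
move=> Ta; rewrite [s a v]sE linearB linearZ /= reflect_self // sE.
by rewrite scalerN opprK addrNK.
Qed.

(* An element maximizing first [- f (g r) / f r] and then the norm of the
   point [r / f r] of the hyperplane [f = 1] spans an extreme ray of the cone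
   of positive roots, whereas a positive root [a] which is not simple is a
   positive combination of [r] and [- s a r] for some [r]. *)
Lemma exists_simple_root (g : 'End(E)) :
  (forall r, T r -> T (g r)) ->
  finite_set [set r | P r /\ f (g r) < 0] ->
  [set r | P r /\ f (g r) < 0] !=set0 ->
  exists2 a, simple_root a & f (g a) < 0.
Proof.
move=> gT finM M0.
have [b [[Tb fb] gb] bmax] :=
  finite_set_argmax (fun r => - f (g r) / f r) finM M0.
set G := - f (g b) / f b in bmax.
have G_gt0 : 0 < G by rewrite divr_gt0 // oppr_gt0.
(* Since [G] is the largest ratio, [phi] is nonnegative on the positive roots; its zeros there are
   the maximizers of the ratio, which form a face of the cone. *)
pose phi r := f (g r) + G * f r.
have phi_ge0 r : P r -> 0 <= phi r.
  move=> [Tr fr]; rewrite /phi; have [gr|gr] := leP 0 (f (g r)).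
    by rewrite addr_ge0 // mulr_ge0 // ltW.
  have := bmax r (conj (conj Tr fr) gr).
  by rewrite ler_pdivrMr // -subr_ge0 opprK addrC.
have phi0M r : P r -> phi r = 0 -> P r /\ f (g r) < 0.
  move=> Pr /eqP; rewrite addr_eq0 => /eqP ->; split => //.
  by rewrite oppr_lt0 mulr_gt0 //; case: Pr.
have finF : finite_set [set r | P r /\ phi r = 0].
  by apply: sub_finite_set finM => r /= [Pr]; exact: phi0M.
have F0 : [set r | P r /\ phi r = 0] !=set0.
  by exists b; split=> //; rewrite /phi /G mulrAC mulfK ?subrr ?addrN ?gt_eqF.
have [a [Pa phia] amax] :=
  finite_set_argmax (fun r => sqnorm ((f r)^-1 *: r)) finF F0.
exists a; last by case: (phi0M a Pa phia).
split=> // r Pr ra; have [Ta fa] := Pa; have [Tr fr] := Pr.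
case: (root_sign (s_root Ta Tr)) => // Pr'; exfalso; apply: ra.
set r' := - s a r in Pr'; have [Tr' fr'] := Pr'; pose c := h a r.
have rr' : r + r' = c *: a by rewrite /r' sE opprB addrC subrK.
have frr' : f r + f r' = c * f a by rewrite -linearD rr' linearZ.
have c_gt0 : 0 < c by rewrite -(pmulr_lgt0 _ fa) -frr' addr_gt0.
(* As [r + r'] is a multiple of [a], where [phi] vanishes, both summands stay in the face and
   compete with [a] for the norm. *)
have phirr' : phi r + phi r' = 0.
  rewrite /phi addrACA -mulrDr -!linearD rr' /= !linearZ /=.
  by move: phia; rewrite /phi mulrCA -mulrDr => ->; rewrite mulr0.
have [phir phir'] : phi r = 0 /\ phi r' = 0.
  by have := phi_ge0 r Pr; have := phi_ge0 r' Pr'; lra.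
have /= := amax r (conj Pr phir); have /= := amax r' (conj Pr' phir').
set x := _ *: r; set y := _ *: r'; set p := _ *: a => qy qx.
pose l := f r / (c * f a).
have l1 : 1 - l = f r' / (c * f a).
  rewrite /l -frr'; field; by rewrite gt_eqF // addr_gt0.
have pE : p = l *: x + (1 - l) *: y.
  have -> : p = (c * f a)^-1 *: (c *: a).
    by rewrite scalerA invfM mulrAC mulVf ?mul1r // gt_eqF.
  rewrite -rr' scalerDr l1 /l /x /y !scalerA.
  by rewrite [f r / _]mulrC [f r' / _]mulrC !mulfK // gt_eqF.
have l_gt0 : 0 < l by rewrite divr_gt0 // mulr_gt0.
have l1_gt0 : 0 < 1 - l by rewrite l1 divr_gt0 // mulr_gt0.
(* [p] lies strictly between [x] and [y] and its norm is at least theirs, so strict convexity forces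
   the two points to coincide. *)
have xy : x = y.
  apply/eqP; rewrite -subr_eq0; apply/eqP/sqnorm_eq0/eqP.
  rewrite eq_le sqnorm_ge0 andbT -(pmulr_rle0 _ (mulr_gt0 l_gt0 l1_gt0)).
  have := sqnorm_convex l x y; rewrite -pE; move: qx qy.
  by nra.
have px : p = x by rewrite pE -xy -scalerDl addrCA subrr addr0 scale1r.
have ar : a = (f a / f r) *: r.
  by rewrite -scalerA -/x -px /p scalerA divff ?scale1r // gt_eqF.
rewrite [RHS]ar; rewrite (@P_reduced r (f a / f r)) ?scale1r // -ar //.
Qed.

(** If neither [r] nor [r'] is [a], then [s a] keeps both positive, hence also [s a a = - a], which
    is absurd. If [r' = a], then [r] is proportional to [a] and reducedness applies. *)
Lemma simple_root_extreme a r r' k k' :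
  simple_root a -> P r -> P r' -> 0 < k -> 0 < k' -> a = k *: r + k' *: r' ->
  r = a.
Proof.
move=> [Pa aP] Pr Pr' k_gt0 k'_gt0 aE; apply: contrapT => ra.
have [Ta fa] := Pa; have [Tr fr] := Pr.
have [r'a|r'a] := pselect (r' = a).
  have fE : f a = k * f r + k' * f a by rewrite {1}aE r'a linearD !linearZ.
  have rE : r = ((1 - k') / k) *: a.
    rewrite mulrC -scalerA scalerBl scale1r {1}aE r'a addrK scalerA.
    by rewrite mulVf ?scale1r // gt_eqF.
  apply: ra; rewrite rE (@P_reduced a ((1 - k') / k)) ?scale1r //.
  by rewrite -rE.
have [_ sr] := aP r Pr ra; have [_ sr'] := aP r' Pr' r'a.
have : 0 < f (s a a).
  rewrite {2}aE linearD !linearZ /= linearD !linearZ /=.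
  by rewrite addr_gt0 // mulr_gt0.
by rewrite reflect_self // linearN oppr_gt0 ltNge ltW.
Qed.

Lemma simple_pair_coef_ge0 a b r k l :
  simple_root a -> simple_root b -> a <> b -> P r -> r = k *: a + l *: b ->
  0 <= k.
Proof.
move=> Sa Sb ab Pr rE; rewrite leNgt; apply/negP => k_lt0; apply: ab.
have [[Ta fa] _] := Sa; have [[Tb fb] _] := Sb; have [Tr fr] := Pr.
have l_gt0 : 0 < l.
  rewrite -(pmulr_lgt0 _ fb); apply: lt_le_trans fr _.
  by rewrite rE linearD !linearZ /= gerDr pmulr_lle0 // ltW.
apply: (@simple_root_extreme b a r (- k / l) l^-1) => //.
- by rewrite divr_gt0 // oppr_gt0.
- by rewrite invr_gt0.
rewrite rE scalerDr !scalerA mulVf ?gt_eqF // scale1r addrA -scalerDl.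
by rewrite mulNr mulrC addNr scale0r add0r.
Qed.

Lemma simple_pair_cone a b r k l :
  simple_root a -> simple_root b -> a <> b -> P r -> r = k *: a + l *: b ->
  0 <= k /\ 0 <= l.
Proof.
move=> Sa Sb ab Pr rE; split.
  exact: (simple_pair_coef_ge0 Sa Sb ab Pr rE).
apply: (simple_pair_coef_ge0 Sb Sa (nesym ab) Pr).
by rewrite rE addrC.
Qed.

(** * Inversion sets of group elements *)

Variable W : set 'End(E).

Hypothesis W1 : W \1%VF.
Hypothesis Ws : forall r, P r -> W (s r).
Hypothesis Wcomp : forall w u, W w -> W u -> W (w \o u)%VF.
Hypothesis WK : forall w, W w -> cancel w (w^-1)%VF.
Hypothesis WVK : forall w, W w -> cancel (w^-1)%VF w.
Hypothesis W_root : forall w r, W w -> T r -> T (w r).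
Hypothesis WV_root : forall w r, W w -> T r -> T ((w^-1)%VF r).

Definition inversions (w : 'End(E)) := [set r | P r /\ f ((w^-1)%VF r) < 0].

Local Notation N := inversions.

Lemma invf_comp w u v :
  W w -> W u -> ((w \o u)^-1)%VF v = (u^-1)%VF ((w^-1)%VF v).
Proof.
move=> Ww Wu; apply: (can_inj (WK Wu)); rewrite WVK //.
by apply: (can_inj (WK Ww)); rewrite WVK // -comp_lfunE WVK //; exact: Wcomp.
Qed.

Lemma invf_reflect a v : P a -> ((s a)^-1)%VF v = s a v.
Proof.
move=> Pa; apply: (can_inj (WK (Ws Pa))).
by rewrite WVK ?reflectK //; [case: Pa | exact: Ws].
Qed.

Lemma inversions_id : N \1%VF = set0.
Proof.
rewrite -subset0 => r [[_ fr]]; have := WVK W1 r; rewrite id_lfunE => ->.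
by rewrite ltNge ltW.
Qed.

Lemma notin_inversions w r : W w -> P r -> ~ N w r -> P ((w^-1)%VF r).
Proof.
move=> Ww [Tr fr] nNr; split; first exact: WV_root.
rewrite lt_neqAle eq_sym f_neq0 /=; last exact: WV_root.
by rewrite leNgt; apply/negP => fwr; apply: nNr.
Qed.

(** Since [s a] permutes the positive roots other than [a], it changes the sign of [(w^-1)%VF r]
    only when this is [a] or [- a]; positivity of [w a] rules out the latter. *)
Lemma inversions_reflect w a :
  W w -> simple_root a -> P (w a) -> N (w \o s a)%VF = w a |` N w.
Proof.
move=> Ww [[Ta fa] aP] Pwa; have Wa := Ws (conj Ta fa).
apply/seteqP; split=> r /=.
  move=> [Pr]; rewrite invf_comp // invf_reflect // => fswr.
  have [Nr|nNr] := pselect (N w r); first by right.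
  left; apply: contrapT => rwa.
  have [|_] := aP _ (notin_inversions Ww Pr nNr).
    by move=> wra; apply: rwa; rewrite -wra WVK.
  by rewrite ltNge ltW.
have NsE r' : N (w \o s a)%VF r' <-> P r' /\ f (s a ((w^-1)%VF r')) < 0.
  by rewrite /inversions /= invf_comp // invf_reflect.
rewrite NsE; case=> [->|[Pr fwr]].
  by split=> //; rewrite WK // reflect_self // linearN oppr_lt0.
split=> //; have Twr : T (- (w^-1)%VF r) by apply/T_opp/WV_root => //; case: Pr.
have [||_] := aP (- (w^-1)%VF r).
- by split=> //; rewrite linearN oppr_gt0.
- move=> ra; have wa : w a = - r by rewrite -ra linearN /= WVK.
  case: Pwa Pr => _; rewrite wa linearN oppr_gt0 => fr [_].
  by rewrite ltNge ltW.
by rewrite linearN linearN oppr_gt0.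
Qed.

(** The element [g], which is [w] followed by the inverse of [z], makes some positive root negative,
    hence also some simple root [a]. *)
Lemma exists_ascent w z :
  W w -> W z -> finite_set (N z) -> N w `<=` N z -> ~ N z `<=` N w ->
  exists2 a, simple_root a & N z (w a).
Proof.
move=> Ww Wz finN Nwz nNzw; pose g := (z^-1 \o w)%VF.
(* If [w r] were negative, [- w r] would be an inversion of [w], hence of [z], contradicting the
   sign of [g r]. *)
have gN r : P r -> f (g r) < 0 -> N z (w r) /\ P (w r).
  rewrite /g comp_lfunE => -[Tr fr] gr.
  suff Pwr : P (w r) by split.
  case: (root_sign (W_root Ww Tr)) => // Pwr; exfalso.
  have [|_] := Nwz (- w r).
    by split=> //; rewrite linearN /= WK // linearN oppr_lt0.
  by rewrite linearN linearN oppr_lt0 ltNge ltW.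
have gT r : T r -> T (g r).
  by move=> Tr; rewrite /g comp_lfunE; apply/WV_root/W_root.
have [||a Sa ga] := exists_simple_root gT; last first.
- by exists a => //; case: (gN a) => //; case: Sa.
- apply: contrapT => M0; apply: nNzw => r Nr; apply: contrapT => nNr.
  have [Pr fr] := Nr; apply: M0; exists ((w^-1)%VF r).
  split; first exact: notin_inversions.
  by rewrite /g comp_lfunE WVK.
apply: (@sub_finite_set _ _ ((w^-1)%VF @` N z)); last exact: finite_image.
by move=> r [Pr gr]; exists (w r); [case: (gN r Pr gr) | rewrite WK].
Qed.

(** * The greatest inversion set inside a finite closed set *)

Section FiniteClosedSet.
Variable C : set E.

Hypothesis CP : C `<=` P.
Hypothesis finC : finite_set C.
Hypothesis Ccone : forall r r' k k', C r -> C r' -> 0 <= k -> 0 <= k' ->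
  P (k *: r + k' *: r') -> C (k *: r + k' *: r').

Lemma exists_dihedral_bound w a b :
  W w -> simple_root a -> simple_root b -> a <> b ->
  N w `<=` C -> C (w a) -> C (w b) ->
  exists w', [/\ W w', N w `<=` N w', N w' `<=` C, N w' (w a) & N w' (w b)].
Proof.
move=> Ww Sa Sb ab NwC Cwa Cwb.
have [Pa aP] := Sa; have [Pb bP] := Sb; have [Ta fa] := Pa; have [Tb fb] := Pb.
have [Twa fwa] := CP Cwa; have [Twb fwb] := CP Cwb.
(* Stated for any linear form, because it is applied to [f \o w] and later to the opposite of
   [f \o (w \o u)]. *)
have cone_gt0 (g : {scalar E}) k l r : 0 < g a -> 0 < g b -> P r ->
    r = k *: a + l *: b -> 0 < g r.
  move=> ga gb Pr rE; have [k0 l0] := simple_pair_cone Sa Sb ab Pr rE.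
  have [_ fr] := Pr; move: k0; rewrite rE linearD !linearZ /= le_eqVlt.
  case/orP=> [/eqP k0|k0]; last first.
    by rewrite ltr_wpDr ?mulr_gt0 // mulr_ge0 // ltW.
  move: l0; rewrite le_eqVlt => /orP[/eqP l0|l0]; last first.
    by rewrite -k0 mul0r add0r mulr_gt0.
  by move: fr; rewrite rE -k0 -l0 !scale0r addr0 linear0 ltxx.
pose span r := exists k l, r = k *: a + l *: b.
have spanD r r' : span r -> span r' -> span (r + r').
  move=> [k [l ->]] [k' [l' ->]]; exists (k + k'), (l + l').
  by rewrite !scalerDl addrACA.
have spanZ t r : span r -> span (t *: r).
  move=> [k [l ->]]; exists (t * k), (t * l).
  by rewrite scalerDr !scalerA.
have span_a : span a by exists 1, 0; rewrite scale1r scale0r addr0.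
have span_b : span b by exists 0, 1; rewrite scale1r scale0r add0r.
have spanN r : span r -> span (- r) by rewrite -scaleN1r; exact: spanZ.
have spanB r r' : span r -> span r' -> span (r - r').
  by move=> Sr Sr'; apply: spanD => //; exact: spanN.
(* [D] stands in for the dihedral group generated by [s a] and [s b]: its elements act trivially
   modulo the span of [a] and [b], and their inverses preserve positivity off that span. *)
pose D u := [/\ W u, forall v, span (u v - v) &
  forall r, P r -> ~ span r -> P ((u^-1)%VF r)].
have D1 : D \1%VF.
  split=> // [v|r Pr _]; last first.
    by have := WVK W1 r; rewrite id_lfunE => ->.
  by rewrite id_lfunE subrr; exists 0, 0; rewrite !scale0r addr0.
have Ds u c : D u -> simple_root c -> span c -> D (u \o s c)%VF.
  move=> [Wu Du uP] [Pc cP] span_c; have Wc := Ws Pc.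
  split; first exact: Wcomp.
    move=> v; rewrite comp_lfunE -[X in span X](subrKA (s c v)).
    apply: spanD => //; rewrite sE addrC addKr; exact/spanN/spanZ.
  move=> r Pr nspan_r; rewrite invf_comp // invf_reflect //.
  apply: cP; first exact: uP.
  move=> urc; apply: nspan_r; rewrite -[r](WVK Wu) urc -(subrK c (u c)).
  exact: spanD.
pose Q A := exists2 u, D u & A = N (w \o u)%VF.
(* A new inversion [r] has [(w^-1)%VF r] positive and in the span, so [r] lies in the cone of [w a]
   and [w b], where [Ccone] applies. *)
have QC A : Q A -> A `<=` C.
  move=> [u [Wu Du uP] ->] r [Pr]; rewrite invf_comp // => fr.
  have [/NwC //|nNr] := pselect (N w r).
  have Pwr := notin_inversions Ww Pr nNr.
  have [[k [l wrE]]|nspan] := pselect (span ((w^-1)%VF r)); last first.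
    by have [_] := uP _ Pwr nspan; rewrite ltNge ltW.
  have [k0 l0] := simple_pair_cone Sa Sb ab Pwr wrE.
  have rE : r = k *: w a + l *: w b by rewrite -!linearZ -linearD -wrE /= WVK.
  by rewrite rE; apply: Ccone => //; rewrite -rE.
(* For an inversion [r] of [w], the positive root [- (w^-1)%VF r] cannot be in the span: [f \o w] is
   positive at [a] and [b] but negative there. *)
have NwD u : D u -> N w `<=` N (w \o u)%VF.
  move=> [Wu Du uP] r [[Tr fr] fwr]; split=> //; rewrite invf_comp //.
  have Pwr : P (- (w^-1)%VF r).
    by split; [apply/T_opp/WV_root | rewrite linearN oppr_gt0].
  have [[k [l wrE]]|nspan] := pselect (span (- (w^-1)%VF r)).
    have := @cone_gt0 [the {scalar E} of f \o w] k l _ fwa fwb Pwr wrE.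
    by rewrite /= linearN /= WVK // linearN oppr_gt0 ltNge ltW.
  by have [_] := uP _ Pwr nspan; rewrite linearN linearN oppr_gt0.
have Q0 : Q (N (w \o \1)%VF) by exists \1%VF.
have [_ [[u Du ->] _ umax]] := finite_maximal_superset finC QC Q0.
have [Wu uspan uP] := Du; have Wwu := Wcomp Ww Wu.
(* Otherwise [w \o u \o s c] would gain the inversion [(w \o u)%VF c], against the maximality of
   [u]. *)
have descent c : simple_root c -> span c -> f ((w \o u)%VF c) < 0.
  move=> Sc span_c; have [[Tc _] _] := Sc.
  rewrite ltNge; apply/negP => f_ge0.
  have Pc : P ((w \o u)%VF c).
    split; first exact: W_root.
    by rewrite lt_neqAle f_ge0 eq_sym f_neq0 //; exact: W_root.
  have [|||_] := umax (N ((w \o u) \o s c)%VF) _ _ ((w \o u)%VF c).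
  - by exists (u \o s c)%VF; [exact: Ds | rewrite comp_lfunA].
  - by rewrite inversions_reflect // => r Nr; right.
  - by rewrite inversions_reflect //; left.
  by rewrite WK //; case: Sc => -[_ fc] _; rewrite ltNge ltW.
(* By [descent], the opposite of [f \o (w \o u)] is positive at [a] and [b]; were [(u^-1)%VF c]
   positive, it would be positive there too, although [w c] is a positive root. *)
have Nw c : simple_root c -> span c -> P (w c) -> N (w \o u)%VF (w c).
  move=> Sc span_c Pwc; have [[Tc fc] _] := Sc; split=> //.
  rewrite invf_comp // WK // ltNge; apply/negP => f_ge0.
  have Pc : P ((u^-1)%VF c).
    split; first exact: WV_root.
    by rewrite lt_neqAle f_ge0 eq_sym f_neq0 //; exact: WV_root.
  have [k [l cE]] : span ((u^-1)%VF c).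
    have := spanB _ _ span_c (uspan ((u^-1)%VF c)).
    by rewrite WVK // subKr.
  have := @cone_gt0 [the {scalar E} of \- (f \o (w \o u)%VF)] k l _ _ _ Pc cE.
  rewrite /= !oppr_gt0 => /(_ (descent a Sa span_a) (descent b Sb span_b)).
  by rewrite comp_lfunE WVK //; case: Pwc => _ fwc; rewrite ltNge ltW.
exists (w \o u)%VF; split=> //; [exact: NwD | by apply: QC; exists u | |].
- by apply: Nw.
- by apply: Nw.
Qed.

Lemma maximal_inversions_unique w z1 z2 :
  let maximal z := [/\ W z, N z `<=` C &
    forall z', W z' -> N z' `<=` C -> N z `<=` N z' -> N z' `<=` N z] in
  W w -> maximal z1 -> maximal z2 -> N w `<=` N z1 -> N w `<=` N z2 ->
  N z1 = N z2.
Proof.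
move=> maximal Ww max1 max2 Nw1 Nw2.
have NwC : N w `<=` C by case: max1 => _ /(subset_trans Nw1).
move AE : (N w) NwC => A AC.
move: A AC w z1 z2 AE Ww max1 max2 Nw1 Nw2.
apply: (finite_superset_ind finC) => A AC IH w z1 z2 AE Ww max1 max2 Nw1 Nw2.
rewrite -{A}AE in AC IH.
have [Wz1 Nz1 z1max] := max1; have [Wz2 Nz2 z2max] := max2.
have finN z : N z `<=` C -> finite_set (N z).
  by move=> NzC; exact: sub_finite_set finC.
have [N1w|nN1w] := pselect (N z1 `<=` N w).
  have N12 := subset_trans N1w Nw2.
  by apply/seteqP; split=> //; exact: z1max.
have [N2w|nN2w] := pselect (N z2 `<=` N w).
  have N21 := subset_trans N2w Nw1.
  by apply/seteqP; split=> //; exact: z2max.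
have [a Sa Nz1a] := exists_ascent Ww Wz1 (finN _ Nz1) Nw1 nN1w.
have [b Sb Nz2b] := exists_ascent Ww Wz2 (finN _ Nz2) Nw2 nN2w.
(* Two maximal elements sharing the inversion [w c] both lie above [w \o s c], to which the
   induction hypothesis applies. *)
have step c y1 y2 z : simple_root c -> N z (w c) -> maximal y1 -> maximal y2 ->
    N w `<=` N y1 -> N w `<=` N y2 -> N y1 (w c) -> N y2 (w c) -> N y1 = N y2.
  move=> Sc Nzc My1 My2 Nwy1 Nwy2 Ny1c Ny2c; have [Pwc _] := Nzc.
  have [Pc _] := Sc; have NwE := inversions_reflect Ww Sc Pwc.
  have sub y : N w `<=` N y -> N y (w c) -> N (w \o s c)%VF `<=` N y.
    by move=> Nwy Nyc; rewrite NwE => r [->|/Nwy].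
  apply: (IH (N (w \o s c)%VF) _ _ _ (w \o s c)%VF) => //.
  - by case: My1 => _ Ny1C _; apply: subset_trans (sub y1 _ _) Ny1C.
  - by rewrite NwE => r Nr; right.
  - rewrite NwE => /(_ (w c) (or_introl erefl)) [_].
    by rewrite WK //; case: Pc => _ fc; rewrite ltNge ltW.
  - exact/Wcomp/Ws.
  - exact: sub.
  - exact: sub.
have [ab|ab] := pselect (a = b).
  by apply: (step a z1 z2 z1) => //; rewrite ab.
(* A maximal [z3] above the dihedral bound shares [w a] with [z1] and [w b] with [z2], so it links
   the two. *)
have [w' [Ww' Nww' Nw'C w'a w'b]] := exists_dihedral_bound
  Ww Sa Sb ab AC (Nz1 _ Nz1a) (Nz2 _ Nz2b).
have QC A : (exists2 z, W z & A = N z /\ A `<=` C) -> A `<=` C by case=> ? _ [].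
have Qw' : exists2 z, W z & N w' = N z /\ N w' `<=` C by exists w'.
have [_ [[z3 Wz3 [-> Nz3C]] Nw'3 z3max]] := finite_maximal_superset finC QC Qw'.
have max3 : maximal z3.
  by split=> // z Wz NzC; apply: z3max; exists z.
have Nw3 := subset_trans Nww' Nw'3.
rewrite (step a z1 z3 z1 Sa) //; last exact: Nw'3.
by apply: (step b z3 z2 z2 Sb) => //; exact: Nw'3.
Qed.

(** The identity has no inversions and so lies below every maximal element, which makes uniqueness
    global. *)
Lemma exists_greatest_inversions :
  exists z, [/\ W z, N z `<=` C &
    forall x, W x -> N x `<=` C -> N x `<=` N z].
Proof.
pose Q A := exists2 z, W z & A = N z /\ A `<=` C.
have QC A : Q A -> A `<=` C by case=> ? _ [].
have maxP x : W x -> N x `<=` C -> exists z, [/\ W z, N z `<=` C, N x `<=` N z &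
    forall z', W z' -> N z' `<=` C -> N z `<=` N z' -> N z' `<=` N z].
  move=> Wx NxC; have Qx : Q (N x) by exists x.
  have [_ [[z Wz [-> NzC]] Nxz zmax]] := finite_maximal_superset finC QC Qx.
  by exists z; split=> // z' Wz' Nz'C; apply: zmax; exists z'.
have N1 y : N \1%VF `<=` y by rewrite inversions_id; exact: sub0set.
have [z [Wz NzC _ zmax]] := maxP _ W1 (N1 C).
exists z; split=> // x Wx NxC; have [y [Wy NyC Nxy ymax]] := maxP x Wx NxC.
by rewrite (@maximal_inversions_unique \1%VF z y).
Qed.

End FiniteClosedSet.

End RootsAndInversions.

(** * A linear form detecting positive affine roots *)

Section AffineHeight.
Variables (R : realType) (V : vectType R) (n : nat) (Pi : n.-tuple V).

Local Notation V' := (affine_space V).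

Definition height (v : V) : R := \sum_i coord Pi i v.

Lemma height_is_linear : linear_for *%R height.
Proof.
move=> k u v; rewrite /height mulr_sumr -big_split; apply: eq_bigr => i _.
by rewrite linearP.
Qed.

HB.instance Definition _ :=
  GRing.isLinear.Build R V R *%R height height_is_linear.

(** [M] is to exceed the absolute heights of all finite roots, so that a nonzero coefficient of
    [delta] decides the sign on a root. *)
Definition affine_height (M : R) (r : V') : R := height r.1 + M * r.2.

Lemma affine_height_is_linear M : linear_for *%R (affine_height M).
Proof. move=> k u v; rewrite /affine_height /= linearP /= mulrDr mulrDr addrACA.
by rewrite (mulrCA M k). Qed.

HB.instance Definition _ M :=
  GRing.isLinear.Build R V' R *%R (affine_height M) (affine_height_is_linear M).

End AffineHeight.

(** * Affine roots and the affine Weyl group as an instance *)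

Section AffineRoots.
Variables (R : realType) (V : vectType R) (dot : {dot V for idfun}).
Variables (n : nat) (Phi : set V) (Pi : n.-tuple V).
Hypothesis hPhi : crystallographic_root_system dot Phi.
Hypothesis hPi : simple_system Phi Pi.

Local Notation V' := (affine_space V).
Local Notation height := (height Pi).

Lemma dot_root_neq0 a : Phi a -> dot a a != 0.
Proof.
move=> Pa; rewrite gt_eqF // neq0_dnorm_gt0 //; apply/eqP => a0.
by have := root_neq0 hPhi; rewrite -a0.
Qed.

Lemma root_opp a : Phi a -> Phi (- a).
Proof.
move=> Pa; have := root_reflect hPhi Pa Pa.
by rewrite mulfK ?dot_root_neq0 // scaler_nat mulr2n opprD addNKr.
Qed.

(** The simple coordinates of a root share a sign, so a zero sum makes them all vanish. *)
Lemma height_root_neq0 a : Phi a -> height a != 0.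
Proof.
move=> Pa; apply/eqP => ha; apply: (root_neq0 hPhi).
have [_ Pib Pisign] := hPi.
suff c0 i : coord Pi i a = 0.
  have <- // : a = 0.
  by rewrite [a](coord_basis Pib (memvf a)) big1 // => i _; rewrite c0 scale0r.
have [ge0|le0] := Pisign a Pa.
  by have /psumr_eq0P := ha; exact.
have : \sum_i - coord Pi i a = 0 by rewrite sumrN -/(height a) ha oppr0.
move/psumr_eq0P => c0; apply: oppr_inj.
by rewrite oppr0 c0 // => j _; rewrite oppr_ge0.
Qed.

Lemma positive_rootsE a : positive_roots Phi Pi a <-> Phi a /\ 0 < height a.
Proof.
have [_ _ Pisign] := hPi; split=> [[Pa ge0]|[Pa ha]]; split=> //.
  by rewrite lt_neqAle eq_sym height_root_neq0 //; exact: sumr_ge0.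
have [//|le0] := Pisign a Pa; move: ha; rewrite ltNge => /negP[].
by rewrite -oppr_ge0 -sumrN; apply: sumr_ge0 => i _; rewrite oppr_ge0.
Qed.

Lemma negative_rootsE a : negative_roots Phi Pi a <-> Phi a /\ height a < 0.
Proof.
split=> [[b /positive_rootsE[Pb hb] <-]|[Pa ha]].
  by split; [exact: root_opp | rewrite linearN oppr_lt0].
exists (- a); last by rewrite opprK.
by apply/positive_rootsE; split; [exact: root_opp | rewrite linearN oppr_gt0].
Qed.

Lemma exists_height_bound :
  exists M, 0 < M /\ forall a, Phi a -> `|height a| < M.
Proof.
have [Phi0|nPhi0] := pselect (Phi !=set0); last first.
  by exists 1; split=> // a Pa; case: nPhi0; exists a.
have [b Pb bmax] :=
  finite_set_argmax (fun a => `|height a|) (root_finite hPhi) Phi0.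
exists (`|height b| + 1); split=> [|a /bmax /= le_ab]; first exact: ltr_wpDl.
by rewrite (le_lt_trans le_ab) // ltrDl.
Qed.

Definition affine_roots : set V' := [set r | Phi r.1 /\ r.2 \is a Num.int].

Local Notation T := affine_roots.

Lemma affine_roots_opp r : T r -> T (- r).
Proof. by move=> [r1 r2]; split; [exact: root_opp | rewrite rpredN]. Qed.

Lemma affine_roots_reflection r v : T r -> T v -> T (reflection dot r v).
Proof.
move=> [r1 r2] [v1 v2]; rewrite reflectionE; split; first exact: root_reflect.
have [z /= zE] := root_integral hPhi r1 v1.
by rewrite /reflection_fun /affine_dot zE /= rpredB // rpredM // intr_int.
Qed.

Section Height.
Variable M : R.
Hypothesis M_gt0 : 0 < M.
Hypothesis height_lt : forall a, Phi a -> `|height a| < M.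

Local Notation f := (affine_height Pi M).
Local Notation P := [set r | T r /\ 0 < f r].

Lemma affine_height_neq0 r : T r -> f r != 0.
Proof.
move=> [r1 r2]; apply/eqP => /eqP; rewrite addr_eq0 => /eqP hE.
have [r0|r0] := eqVneq r.2 0.
  by have := height_root_neq0 r1; rewrite hE r0 mulr0 oppr0 eqxx.
have := height_lt r1; rewrite hE normrN normrM (gtr0_norm M_gt0) ltNge.
by rewrite ler_peMr ?norm_intr_ge1 // ltW.
Qed.

Lemma affine_positive_rootsE : affine_positive_roots Phi Pi = P.
Proof.
apply/seteqP; split=> r /=.
  have affineE a (m : nat) : f (embed a + m%:R *: delta V) =
      height a + M * m%:R.
    by rewrite /affine_height /= scaler0 addr0 add0r [_ *: _]mulr1.
  have affineT a (m : nat) : Phi a -> T (embed a + m%:R *: delta V).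
    by split=> /=; rewrite ?scaler0 ?addr0 // add0r [_ *: _]mulr1 natr_int.
  move=> [a Pa [k [[/positive_rootsE[_ ha] ->]|[/negative_rootsE[_ ha] ->]]]].
    by split; [exact: affineT | rewrite affineE ltr_wpDr // mulr_ge0 // ltW].
  split; first exact: affineT.
  have := height_lt Pa; rewrite ltr0_norm // => haM.
  (* The shift to [k.+1] gives a negative finite root at least one [delta], which outweighs its
     height. *)
  have : M <= M * k.+1%:R by rewrite ler_peMr ?ler1n // ltW.
  by rewrite affineE; lra.
move=> [[r1 /intrP[z zE]] fr]; exists r.1 => //.
have rE (m : nat) : z = m -> r = embed r.1 + m%:R *: delta V.
  move=> zm; case: r {r1 fr} zE => r1 r2 /= ->; rewrite zm /embed /delta.
  by congr pair; rewrite /= ?scaler0 ?addr0 // add0r [_ *: _]mulr1.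
move: fr; rewrite /affine_height zE => fr.
have := height_lt r1; rewrite ltr_norml => /andP[geM leM].
have [h_lt0|h_gt0|h0] := ltgtP (height r.1) 0.
- case: z zE fr rE => [[|k]|k] zE fr rE.
  + by move: fr; rewrite mulr0 addr0 ltNge ltW.
  + by exists k; right; split; [exact/negative_rootsE | exact: rE].
  + have : M * (Negz k)%:~R <= 0 by rewrite pmulr_rle0 // lerz0.
    by move: fr; lra.
- case: z zE fr rE => [k|k] zE fr rE.
    by exists k; left; split; [exact/positive_rootsE | exact: rE].
  have : M * (Negz k)%:~R <= - M.
    by rewrite -mulrN1 ler_pM2l // -[-1]/((-1)%:~R) ler_int NegzE lerN2.
  by move: fr; lra.
- by have := height_root_neq0 r1; rewrite h0 eqxx.
Qed.

Lemma affine_negative_rootsE :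
  affine_negative_roots Phi Pi = [set r | T r /\ f r < 0].
Proof.
rewrite /affine_negative_roots affine_positive_rootsE.
apply/seteqP; split=> r /=.
  move=> [s [Ts fs] <-]; split; first exact: affine_roots_opp.
  by rewrite linearN oppr_lt0.
move=> [Tr fr]; exists (- r); last by rewrite opprK.
by split; [exact: affine_roots_opp | rewrite linearN oppr_gt0].
Qed.

Lemma affine_roots_reduced r (t : R) : P r -> P (t *: r) -> t = 1.
Proof.
move=> [[r1 _] fr] [[tr1 _]]; rewrite linearZ /=.
have [//|->] := root_reduced hPhi r1 tr1.
by rewrite mulN1r oppr_gt0 ltNge ltW.
Qed.

Local Notation W := (affine_weyl_group dot Phi Pi).

Definition affine_coroot (r v : V') : R :=
  2 * affine_dot dot v r / affine_dot dot r r.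

Lemma affine_coroot_root r : T r -> affine_coroot r r = 2.
Proof. by move=> [r1 _]; rewrite /affine_coroot mulfK // dot_root_neq0. Qed.

(** The four facts are proved in one induction: injectivity of each generated map is what makes its
    [lfun] inverse a genuine inverse. *)
Lemma affine_weyl_groupP w : W w ->
  [/\ cancel w (w^-1)%VF, cancel (w^-1)%VF w, forall r, T r -> T (w r) &
      forall r, T r -> T ((w^-1)%VF r)].
Proof.
have inj_inv (x : 'End(V')) :
    injective x -> cancel x (x^-1)%VF /\ cancel (x^-1)%VF x.
  by move=> /lker0P kx; split; [exact: lker0_lfunK | exact: lker0_lfunVK].
elim=> {w} [|r|x y _ [xK xVK xT xVT] _ [yK yVK yT yVT]|x _ [xK xVK xT xVT]].
- have [|K VK] := inj_inv (\1%VF : 'End(V')).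
    by move=> u v; rewrite !id_lfunE.
  have VE (v : V') : (\1^-1)%VF v = v by have := VK v; rewrite id_lfunE.
  by split=> // r Tr; rewrite ?id_lfunE ?VE.
- rewrite affine_positive_rootsE => -[Tr _].
  have sK : involutive (reflection dot r).
    by move=> v; exact: (reflectK (@reflectionE R V dot) affine_coroot_root).
  have [K VK] := inj_inv _ (inv_inj sK).
  have VE v : ((reflection dot r)^-1)%VF v = reflection dot r v.
    by apply: (can_inj sK); rewrite VK sK.
  by split=> // v Tv; rewrite ?VE; exact: affine_roots_reflection.
- have [K VK] : cancel (x \o y)%VF ((x \o y)^-1)%VF /\
      cancel ((x \o y)^-1)%VF (x \o y)%VF.
    apply: inj_inv => u v; rewrite !comp_lfunE => /(can_inj xK).
    exact: can_inj.
  have VE v : ((x \o y)^-1)%VF v = (y^-1)%VF ((x^-1)%VF v).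
    by apply: (can_inj K); rewrite VK comp_lfunE yVK xVK.
  by split=> // r Tr; rewrite ?VE ?comp_lfunE; auto.
- have [K VK] := inj_inv _ (can_inj xVK).
  have VE v : ((x^-1)^-1)%VF v = x v by apply: (can_inj xVK); rewrite VK xK.
  by split=> // r Tr; rewrite ?VE; auto.
Qed.

End Height.

End AffineRoots.

(** * Biclosedness of the finite closure and existence of the join *)

Theorem theorem4p2 (R : realType) (V : vectType R) (dot : {dot V for idfun})
    (n : nat) (Phi : set V) (Pi : n.-tuple V)
    (hPhi : crystallographic_root_system dot Phi)
    (hirr : irreducible_root_system dot Phi)
    (hPi : simple_system Phi Pi)
    (X : set 'End(affine_space V))
    (hX : X `<=` affine_weyl_group dot Phi Pi) :
  let C := closure_roots Phi Pi (\bigcup_(x in X) inversion_set Phi Pi x) in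
  finite_set C ->
  biclosed_roots Phi Pi C /\
  exists z : 'End(affine_space V), is_join dot Phi Pi X z.
Proof.
move=> C finC.
have [M [M_gt0 height_lt]] := exists_height_bound Pi hPhi.
pose N := @inversions _ _ (affine_roots Phi) (affine_height Pi M).
have PE := affine_positive_rootsE hPhi hPi M_gt0 height_lt.
have NPE := affine_negative_rootsE hPhi hPi M_gt0 height_lt.
have WP := affine_weyl_groupP hPhi hPi M_gt0 height_lt.
have NE w : affine_weyl_group dot Phi Pi w -> inversion_set Phi Pi w = N w.
  move=> /WP[_ _ _ wT]; apply/seteqP; rewrite /inversion_set NPE PE.
  split=> r [[Tr fr]] /=; first by case.
  by split=> //; split=> //; exact: wT.
have biN w : affine_weyl_group dot Phi Pi w -> biclosed_roots Phi Pi (N w).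
  move=> /WP[_ _ _ wT].
  have fE (k k' : R) a b : affine_height Pi M ((w^-1)%VF (k *: a + k' *: b)) =
      k * affine_height Pi M ((w^-1)%VF a) +
      k' * affine_height Pi M ((w^-1)%VF b).
    by rewrite linearD !linearZ /= linearD !linearZ.
  rewrite /biclosed_roots /closed_roots PE.
  split; split=> [r [] //|a b k k' [Pa fa] [Pb fb] k0 k'0 Pab]; split=> //.
    (* Nonnegative coefficients give only a weak inequality; strictness comes from the form having
       no zero on roots. *)
    have [Tab _] := Pab; rewrite /= lt_neqAle.
    rewrite (affine_height_neq0 hPhi hPi M_gt0 height_lt (wT _ Tab)) fE.
    have := mulr_ge0_le0 k0 (ltW fa); have := mulr_ge0_le0 k'0 (ltW fb); lra.
  case=> _; rewrite /= fE ltNge; apply/negP; rewrite negbK.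
  apply: addr_ge0; apply: mulr_ge0 => //; rewrite leNgt; apply/negP => fwr.
    exact: fa.
  exact: fb.
have closedP : closed_roots Phi Pi (affine_positive_roots Phi Pi).
  by split=> [r|a b k k' _ _ _ _].
have closedC : closed_roots Phi Pi C.
  split.
    by apply: smallest_sub closedP _ => r [x _ []].
  move=> a b k k' Ca Cb k0 k'0 Pab G GY; have [[_ Gcone] _] := GY.
  by apply: Gcone; [exact: Ca GY | exact: Cb GY | | |].
have [CP Ccone] := closedC.
have [z [Wz NzC zmax]] : exists z,
    [/\ affine_weyl_group dot Phi Pi z, N z `<=` C &
     forall x, affine_weyl_group dot Phi Pi x -> N x `<=` C -> N x `<=` N z].
  apply: (@exists_greatest_inversions _ _ (affine_roots Phi)
    (affine_height Pi M) (affine_coroot dot) (reflection dot)) => //.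
  - exact: reflectionE.
  - exact: (affine_coroot_root hPhi).
  - exact: (affine_roots_reflection hPhi).
  - exact: (affine_roots_opp hPhi).
  - exact: (affine_height_neq0 hPhi hPi M_gt0 height_lt).
  - exact: (affine_roots_reduced hPhi).
  - exact: Weyl_id.
  - by move=> r; rewrite -PE; exact: Weyl_reflection.
  - exact: Weyl_comp.
  - by move=> w /WP[].
  - by move=> w /WP[].
  - by move=> w r /WP[_ _ + _]; exact.
  - by move=> w r /WP[_ _ _]; exact.
  - by rewrite -PE.
  - by rewrite -PE.
have XC x : X x -> N x `<=` C.
  move=> Xx; rewrite -NE; last exact: hX.
  by apply: sub_smallest; exact: bigcup_sup.
(* [N z] is closed and contains every [N x] with [x] in [X], so it contains the smallest such
   set. *)
have CE : C = N z.
  apply/seteqP; split=> //; apply: smallest_sub; first by case: (biN z Wz).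
  move=> r [x Xx]; rewrite NE; last exact: hX.
  by apply: zmax; [exact: hX | exact: XC].
split; first by rewrite CE; exact: biN.
exists z; split=> // [x Xx|w Ww Xw]; rewrite /weak_le !NE //; try exact: hX.
  by rewrite -CE; exact: XC.
rewrite -CE; apply: smallest_sub; first by case: (biN w Ww).
by move=> r [x Xx]; rewrite -[N w]NE //; exact: Xw.
Qed.
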